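(* Let $(\varepsilon_n)_{n=1}^\infty$ be any sequence of nonnegative real numbers such that $\sum_{n=1}^\infty \varepsilon_n<\infty$. Then every normalized $(1+\varepsilon_n)$-bounded M-basis $\{x_n,x_n^*\}_{n\in\mathbb{N}}$ of $\ell_2$ is equivalent to an orthonormal basis of $\ell_2$.
   Context: Let $X$ be a Banach space with dual $X^*$. A Markushevich basis (M-basis) of $X$ is a biorthogonal sequence $\{x_n,x_n^*\}_{n\in\mathbb{N}}$ in $X\times X^*$ (that is, $x_n^*(x_m)=1$ if $n=m$ and $0$ otherwise) such that $\{x_n\}$ is fundamental (the linear span of $\{x_n\}$ is norm dense in $X$) and $\{x_n^*\}$ is total (if $x\in X$ and $x_n^*(x)=0$ for all $n$, then $x=0$). Given a sequence of nonnegative numbers $(\varepsilon_n)$, an M-basis is called $(1+\varepsilon_n)$-bounded if $\|x_n\|\cdot\|x_n^*\|\le 1+\varepsilon_n$ for all $n\in\mathbb{N}$. It is normalized if $\|x_n\|=1$ for all $n$. A set of vectors $\{x_n\}_n$ in $X$ is called minimal if there exist functionals $\{x_n^*\}_n\subset X^*$ such that $\{x_n,x_n^*\}_n$ is biorthogonal. Two minimal systems $\{x_n\}_n$ and $\{y_n\}_n$ are called equivalent if the linear map $A$ defined by $Ax_n=y_n$ for all $n$ is (extends to) a bounded isomorphism of $\overline{\operatorname{span}}\{x_n\}_n$ onto $\overline{\operatorname{span}}\{y_n\}_n$, i.e. $\|A\|\cdot\|A^{-1}\|<\infty$. Saying that an M-basis $\{x_n,x_n^*\}$ is equivalent to a basis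 refers to the vectors $\{x_n\}$. *)

(* Defs.v *)
From HB Require Import structures.
From mathcomp Require Import all_boot all_order all_algebra.
From mathcomp Require Import all_classical all_reals all_analysis.
From mathcomp Require Import complex ring lra.

Set Implicit Arguments.
Unset Strict Implicit.
Unset Printing Implicit Defensive.

Import Order.TTheory GRing.Theory Num.Theory.
Import numFieldNormedType.Exports.
Local Open Scope classical_set_scope.
Local Open Scope ring_scope.

(** The scalar field is either [R] or [R[i]].  Norms in a [normedModType K]
    take their values in [K]; [modulus] and [ofreal] move between these and
    the real numbers. *)

Variant scalar_kind := RealScalars | ComplexScalars.

Definition scalar (R : realType) (F : scalar_kind) : numFieldType :=
  match F with
  | RealScalars => R
  | ComplexScalars => R[i]
  end.

Definition modulus (R : realType) (F : scalar_kind) : scalar R F -> R :=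
  match F return scalar R F -> R with
  | RealScalars => fun a => `|a|
  | ComplexScalars => fun a => ComplexField.Normc.normc a
  end.

Definition ofreal (R : realType) (F : scalar_kind) : R -> scalar R F :=
  match F return R -> scalar R F with
  | RealScalars => id
  | ComplexScalars => fun r => r%:C%C
  end.

Definition conjugate (R : realType) (F : scalar_kind) :
    scalar R F -> scalar R F :=
  match F return scalar R F -> scalar R F with
  | RealScalars => id
  | ComplexScalars => fun a => conjc a
  end.

Section ScalarTheory.
Context (R : realType) (F : scalar_kind).
Implicit Types (a b : scalar R F) (r s : R).

Lemma modulusE a : `|a| = ofreal F (modulus a).
Proof. by case: F a => //= -[u v]; rewrite normc_def. Qed.

Lemma modulus_ge0 a : 0 <= modulus a.
Proof. by case: F a => [a|[u v]] /=; [exact: normr_ge0 | exact: sqrtr_ge0]. Qed.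

Lemma modulus0 : modulus (0 : scalar R F) = 0.
Proof. by case: F => /=; [exact: normr0 | exact: ComplexField.Normc.normc0]. Qed.

Lemma modulus0_eq0 a : modulus a = 0 -> a = 0.
Proof.
case: F a => [a /normr0_eq0 //|a]; exact: ComplexField.Normc.eq0_normc.
Qed.

Lemma modulusD a b : modulus (a + b) <= modulus a + modulus b.
Proof. by case: F a b => [a b|a b]; [exact: ler_normD | exact: le_normcD]. Qed.

Lemma modulusM a b : modulus (a * b) = modulus a * modulus b.
Proof.
by case: F a b => [a b|a b]; [exact: normrM | exact: ComplexField.Normc.normcM].
Qed.

Lemma ofreal0 : ofreal F (0 : R) = 0. Proof. by case: F. Qed.

Lemma ofrealD r s : ofreal F (r + s) = ofreal F r + ofreal F s.
Proof. by case: F => //=; exact: rmorphD. Qed.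

Lemma ofrealM r s : ofreal F (r * s) = ofreal F r * ofreal F s.
Proof. by case: F => //=; exact: rmorphM. Qed.

Lemma ler_ofreal r s : (ofreal F r <= ofreal F s) = (r <= s).
Proof. by case: F => //=; exact: lecR. Qed.

Lemma modulus_ofreal r : modulus (ofreal F r) = `|r|.
Proof. by case: F => //=; rewrite expr0n addr0 sqrtr_sqr. Qed.

Lemma normr_ofreal r : `|ofreal F r| = ofreal F `|r|.
Proof. by rewrite modulusE modulus_ofreal. Qed.

Lemma ltr_ofreal r s : (ofreal F r < ofreal F s) = (r < s).
Proof. by case: F => //=; exact: ltcR. Qed.

Lemma ofrealB r s : ofreal F (r - s) = ofreal F r - ofreal F s.
Proof. by case: F => //=; exact: rmorphB. Qed.

Lemma mul_conjugate a : a * conjugate a = ofreal F (modulus a ^+ 2).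
Proof.
case: F a => [a|[u v]] /=; first by rewrite real_normK ?num_real// expr2.
by rewrite -(sqr_normc (Complex u v)) normc_def -rmorphXn.
Qed.

Lemma cvg_ofreal (u : nat -> R) (l : R) : u n @[n --> \oo] --> l ->
  (ofreal F (u n) : (scalar R F)^o) @[n --> \oo] --> (ofreal F l : (scalar R F)^o).
Proof.
move=> ul; apply/cvgrPdist_lt => e e0.
have e1 : e = ofreal F (modulus e) by rewrite -modulusE gtr0_norm.
have me : 0 < modulus e by rewrite -ltr_ofreal ofreal0 -e1.
move/cvgrPdist_lt : ul => /(_ _ me); apply: filterS => n h.
by rewrite -ofrealB normr_ofreal e1 ltr_ofreal.
Qed.

Lemma ofreal_inj : injective (@ofreal R F).
Proof. by case: F => [|r s []]. Qed.

End ScalarTheory.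

Definition square_summable (R : realType) (F : scalar_kind)
    : {pred nat -> (scalar R F)^o} :=
  [pred x | `[< cvgn (series (fun n => modulus (x n) ^+ 2)) >]].

Section SquareSummable.
Context (R : realType) (F : scalar_kind).
Local Notation K := (scalar R F).

Lemma square_summableP (x : nat -> K) :
  reflect (cvgn (series (fun n => modulus (x n) ^+ 2)))
          (x \in @square_summable R F).
Proof. by rewrite inE; exact: asboolP. Qed.

Lemma square_summable_submod : submod_closed (@square_summable R F).
Proof.
split.
  apply/square_summableP.
  rewrite (_ : (fun _ => _) = fun=> 0).
    by rewrite (_ : series _ = fun=> 0); [exact: is_cvg_cst |
       apply/funext => n; rewrite /series /= big1].
  by apply/funext => n; rewrite [X in modulus X]/= modulus0 expr0n.
move=> a u v /square_summableP cu /square_summableP cv.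
apply/square_summableP.
pose w := (2 * modulus a ^+ 2) *: (fun n => modulus (u n) ^+ 2)
          + 2 *: (fun n => modulus (v n) ^+ 2) : nat -> R^o.
have cw : cvgn (series w).
  rewrite /w; apply: is_cvg_seriesD; exact: is_cvg_seriesZ.
apply: (series_le_cvg _ _ _ cw) => n.
- exact: sqr_ge0.
- by rewrite /w /=; apply: addr_ge0; apply: mulr_ge0; rewrite ?mulr_ge0 ?exprn_ge0 ?modulus_ge0.
change (modulus (a * u n + v n) ^+ 2 <=
  2 * modulus a ^+ 2 * modulus (u n) ^+ 2 + 2 * modulus (v n) ^+ 2).
have := modulusD (a * u n) (v n); rewrite modulusM.
have := modulus_ge0 (a * u n + v n).
move: (modulus _) (modulus a) (modulus (u n)) (modulus (v n)) => p q r t p0 h.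
by have := sqr_ge0 (q * r - t); nra.
Qed.

HB.instance Definition _ := GRing.isSubmodClosed.Build K _
  (@square_summable R F) square_summable_submod.

End SquareSummable.

Record ell2 (R : realType) (F : scalar_kind) := Ell2 {
  ell2_seq :> nat -> (scalar R F)^o ;
  ell2P : ell2_seq \in @square_summable R F }.

HB.instance Definition _ (R : realType) (F : scalar_kind) :=
  [isSub for @ell2_seq R F].
HB.instance Definition _ (R : realType) (F : scalar_kind) :=
  [Choice of ell2 R F by <:].
HB.instance Definition _ (R : realType) (F : scalar_kind) :=
  [SubChoice_isSubLmodule of ell2 R F by <:].

Section Ell2Norm.
Context (R : realType) (F : scalar_kind).
Local Notation K := (scalar R F).
Implicit Types x y : ell2 R F.

Definition ell2_norm x : R :=
  Num.sqrt (limn (series (fun n => modulus (x n) ^+ 2))).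

Lemma ell2_cvg x : cvgn (series (fun n => modulus (x n) ^+ 2)).
Proof. by apply/square_summableP; exact: ell2P. Qed.

Lemma ell2_norm_ge0 x : 0 <= ell2_norm x.
Proof. exact: sqrtr_ge0. Qed.

Lemma ell2_partial_sum_le x N :
  series (fun n => modulus (x n) ^+ 2) N <=
  limn (series (fun n => modulus (x n) ^+ 2)).
Proof.
apply: nondecreasing_cvgn_le; last exact: ell2_cvg.
by apply: nondecreasing_series => n _ _; exact: sqr_ge0.
Qed.

Lemma sqr_ell2_norm x :
  ell2_norm x ^+ 2 = limn (series (fun n => modulus (x n) ^+ 2)).
Proof.
rewrite sqr_sqrtr//; apply: le_trans (ell2_partial_sum_le x 0).
by rewrite /series /= big_geq.
Qed.

Lemma ell2_norm_eq0 x : ell2_norm x = 0 -> x = 0.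
Proof.
move=> x0; apply/val_inj/funext => n; apply: modulus0_eq0; apply/eqP.
have := ell2_partial_sum_le x n.+1.
rewrite -sqr_ell2_norm x0 expr0n /series /= big_nat_recr//= => h.
have s0 : 0 <= \sum_(0 <= i < n) modulus (x i) ^+ 2.
  by apply: sumr_ge0 => i _; exact: sqr_ge0.
suff : modulus (x n) ^+ 2 == 0 by rewrite expf_eq0.
rewrite eq_le sqr_ge0 andbT.
by apply: le_trans h; rewrite lerDr.
Qed.

Lemma ell2_normZ (a : K) x : ell2_norm (a *: x) = modulus a * ell2_norm x.
Proof.
rewrite -[LHS]ger0_norm ?ell2_norm_ge0// -sqrtr_sqr.
rewrite -[RHS]ger0_norm ?mulr_ge0 ?modulus_ge0 ?ell2_norm_ge0// -[RHS]sqrtr_sqr.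
congr Num.sqrt; rewrite exprMn !sqr_ell2_norm.
rewrite -[RHS]/(_ *: _) -(lim_seriesZ _ (@ell2_cvg x)).
congr (limn (series _)); apply/funext => n.
change (modulus (a * x n) ^+ 2 = modulus a ^+ 2 * modulus (x n) ^+ 2).
by rewrite modulusM exprMn.
Qed.

Lemma ell2_normD x y : ell2_norm (x + y) <= ell2_norm x + ell2_norm y.
Proof.
have [x0|x0] := eqVneq (ell2_norm x) 0.
  by rewrite (ell2_norm_eq0 x0) add0r lerDr ell2_norm_ge0.
have [y0|y0] := eqVneq (ell2_norm y) 0.
  by rewrite (ell2_norm_eq0 y0) addr0 lerDl ell2_norm_ge0.
have A0 : 0 < ell2_norm x by rewrite lt_neqAle eq_sym x0 ell2_norm_ge0.
have B0 : 0 < ell2_norm y by rewrite lt_neqAle eq_sym y0 ell2_norm_ge0.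
rewrite -ler_sqr ?nnegrE ?ell2_norm_ge0 ?addr_ge0// ?ell2_norm_ge0//.
pose c : R := ell2_norm y / ell2_norm x.
have c0 : 0 < c by rewrite divr_gt0.
have -> : (ell2_norm x + ell2_norm y) ^+ 2 =
    (1 + c) * ell2_norm x ^+ 2 + (1 + c^-1) * ell2_norm y ^+ 2.
  by rewrite /c; field; rewrite x0 y0.
rewrite (sqr_ell2_norm (x + y)); apply: (cvgr_to_le (@ell2_cvg (x + y))).
near=> N.
apply: (@le_trans _ _ (
  (1 + c) * series (fun n => modulus (x n) ^+ 2) N +
  (1 + c^-1) * series (fun n => modulus (y n) ^+ 2) N)); last first.
  rewrite !sqr_ell2_norm; apply: lerD; apply: ler_wpM2l; 
    by rewrite ?ell2_partial_sum_le// addr_ge0// ltW// invr_gt0.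
rewrite /series /= !mulr_sumr -big_split/=; apply: ler_sum => i _.
have := modulusD (x i) (y i).
change ((x + y) i) with (x i + y i).
have := modulus_ge0 (x i + y i).
move: (modulus _) (modulus (x i)) (modulus (y i)) => p q r p0 h.
apply: (@le_trans _ _ ((q + r) ^+ 2)).
  by rewrite ler_sqr ?nnegrE// (le_trans p0).
rewrite -subr_ge0 [X in 0 <= X](_ : _ = (c * q - r) ^+ 2 / c).
  by rewrite divr_ge0 ?sqr_ge0// ltW.
by field; rewrite gt_eqF.
Unshelve. all: by end_near. Qed.

Let normD x y :
  ofreal F (ell2_norm (x + y)) <=
  ofreal F (ell2_norm x) + ofreal F (ell2_norm y).
Proof. by rewrite -ofrealD ler_ofreal ell2_normD. Qed.

Let normZ (a : K) x :
  ofreal F (ell2_norm (a *: x)) = `|a| * ofreal F (ell2_norm x).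
Proof. by rewrite modulusE -ofrealM ell2_normZ. Qed.

Let norm_eq0 x : ofreal F (ell2_norm x) = 0 -> x = 0.
Proof. by rewrite -ofreal0 => /ofreal_inj/ell2_norm_eq0. Qed.

HB.instance Definition _ :=
  @Lmodule_isNormed.Build K (ell2 R F) (fun x => ofreal F (ell2_norm x))
    normD normZ norm_eq0.

Definition inner x y : K :=
  limn (series (fun n => x n * conjugate (y n)) : nat -> K^o).

Lemma inner_self x : inner x x = `|x| ^+ 2.
Proof.
transitivity (ofreal F (ell2_norm x ^+ 2)); last by rewrite expr2 ofrealM -expr2.
apply/cvg_lim => //; rewrite sqr_ell2_norm.
rewrite [X in X @ _ --> _](_ : _ =
    fun N => ofreal F (series (fun n => modulus (x n) ^+ 2) N)); last first.
  apply/funext => N; elim: N => [|N IH].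
    by rewrite /series /= !big_geq// ofreal0.
  by rewrite !seriesSr/= ofrealD -IH mul_conjugate.
by apply: cvg_ofreal; exact: ell2_cvg.
Qed.

End Ell2Norm.

Section Bases.
Context (R : realType) (F : scalar_kind).
Local Notation K := (scalar R F).

Record top_dual (X : normedModType K) := Dual {
  dual_fun :> {linear X -> K^o} ;
  dual_continuous : continuous dual_fun }.

Definition rnorm (X : normedModType K) (v : X) : R := modulus `|v|.

Lemma rnorm_ell2 (x : ell2 R F) : rnorm x = ell2_norm x.
Proof. by rewrite /rnorm modulus_ofreal ger0_norm ?ell2_norm_ge0. Qed.

Definition dual_norm (X : normedModType K) (f : top_dual X) : R :=
  sup [set modulus (f v) | v in [set v : X | rnorm v <= 1]].

Definition linear_span (X : normedModType K) (x : nat -> X) : set X :=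
  [set v | exists N (a : nat -> K), v = \sum_(i < N) a i *: x i].

Definition closed_span (X : normedModType K) (x : nat -> X) : set X :=
  closure (linear_span x).

Definition fundamental (X : normedModType K) (x : nat -> X) : Prop :=
  dense (linear_span x).

Definition total_family (X : normedModType K) (f : nat -> top_dual X) : Prop :=
  forall v : X, (forall n, f n v = 0) -> v = 0.

Definition biorthogonal (X : normedModType K) (x : nat -> X)
    (f : nat -> top_dual X) : Prop :=
  forall n m, f n (x m) = (n == m)%:R.

Definition M_basis (X : normedModType K) (x : nat -> X) (f : nat -> top_dual X)
    : Prop :=
  [/\ biorthogonal x f, fundamental x & total_family f].

Definition bounded_by (X : normedModType K) (eps : nat -> R) (x : nat -> X)
    (f : nat -> top_dual X) : Prop :=
  forall n, rnorm (x n) * dual_norm (f n) <= 1 + eps n.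

Definition normalized (X : normedModType K) (x : nat -> X) : Prop :=
  forall n, rnorm (x n) = 1.

Definition minimal (X : normedModType K) (x : nat -> X) : Prop :=
  exists f : nat -> top_dual X, biorthogonal x f.

Definition linear_on (X Y : normedModType K) (E : set X) (A : X -> Y) : Prop :=
  forall (a : K) u v, E u -> E v -> A (a *: u + v) = a *: A u + A v.

Definition bounded_on (X Y : normedModType K) (E : set X) (A : X -> Y) : Prop :=
  exists C : R, forall u, E u -> rnorm (A u) <= C * rnorm u.

(** [A] and [B] are only constrained on the closed spans: they represent the
    isomorphism between these and its inverse. *)
Definition equivalent (X Y : normedModType K) (x : nat -> X) (y : nat -> Y)
    : Prop :=
  [/\ minimal x, minimal y &
    exists (A : X -> Y) (B : Y -> X),
      [/\ forall n, A (x n) = y n,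
          linear_on (closed_span x) A /\ linear_on (closed_span y) B,
          bounded_on (closed_span x) A /\ bounded_on (closed_span y) B,
          forall u, closed_span x u -> closed_span y (A u) /\ B (A u) = u &
          forall v, closed_span y v -> closed_span x (B v) /\ A (B v) = v]].

Definition orthonormal_basis (e : nat -> ell2 R F) : Prop :=
  (forall n m, inner (e n) (e m) = (n == m)%:R) /\ fundamental e.

End Bases.

(* Main.v *)
Require Import Defs.
From HB Require Import structures.
From mathcomp Require Import all_boot all_order all_algebra.
From mathcomp Require Import all_classical all_reals all_analysis.
From mathcomp Require Import complex ring lra.

Set Implicit Arguments.
Unset Strict Implicit.
Unset Printing Implicit Defensive.

Import Order.TTheory GRing.Theory Num.Theory.
Import numFieldNormedType.Exports.
Local Open Scope classical_set_scope.
Local Open Scope ring_scope.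

(** If [g] has norm at most [1 + e] and takes the value [1] at a unit vector
    [x], then [x] nearly represents [g]: by Pythagoras the part of the Riesz
    representative of [g] orthogonal to [x] has squared norm at most
    [(1 + e)^2 - 1 = 2 e + e^2].  For the given M-basis, [f n u]
    therefore differs from [<u, x n>] by at most [d n * |u|], where
    [d n ^ 2 = 2 * eps n + eps n ^ 2] is summable.

    Take [u = \sum_(n < N) a n *: x n], so that [f n u = a n].  Expanding
    [|u|^2 = <u, u>] along the sum gives [\sum_n <a n *: x n, u>], whose terms
    are [|a n|^2] up to [|a n| * d n * |u|].  Hence [|u|^2] and
    [\sum_n |a n|^2] differ by at most [(\sum_n |a n|^2)^(1/2) * D^(1/2) * |u|]
    with [D = \sum_n d n ^ 2], and two nonnegative quantities whose squares
    differ by at most a multiple of their product are comparable, however large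
    the multiple is ([riesz_upper], [riesz_lower]).

    By density the lower estimate makes the coefficient map [u |-> (f n u)_n]
    bounded into l2 ([coefficients_bounded]); completeness of l2 and the upper
    estimate make it onto ([coefficients_onto]), and totality makes it
    injective.  It sends [x n] to the [n]-th unit vector, so the standard
    orthonormal basis is the one sought.

    Real and complex scalars are treated together: only the real part of the
    inner product enters the estimates, and it is obtained from the norm by
    polarization. *)

(** * Scalars *)

Section Scalars.
Context (R : realType) (F : scalar_kind).
Local Notation K := (Defs.scalar R F).
Implicit Types a b c : K.

Lemma modulus_add3 a b c :
  modulus (a + b + c) ^+ 2 + modulus a ^+ 2 + modulus b ^+ 2 + modulus c ^+ 2 =
  modulus (a + b) ^+ 2 + modulus (a + c) ^+ 2 + modulus (b + c) ^+ 2.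
Proof.
case: F a b c => [a b c|[a1 a2] [b1 b2] [c1 c2]] /=.
  by rewrite !real_normK ?num_real//; ring.
by rewrite !sqr_sqrtr ?addr_ge0 ?sqr_ge0//; ring.
Qed.

Lemma modulus_line (s : R) a b :
  modulus (a + ofreal F s * b) ^+ 2 =
  (1 - s) * modulus a ^+ 2 + s * modulus (a + b) ^+ 2
  + (s ^+ 2 - s) * modulus b ^+ 2.
Proof.
case: F a b => [a b|[a1 a2] [b1 b2]] /=.
  by rewrite !real_normK ?num_real//; ring.
by rewrite !sqr_sqrtr ?addr_ge0 ?sqr_ge0//; ring.
Qed.

Lemma modulus1 : modulus (1 : K) = 1.
Proof. by case: F => /=; rewrite ?normr1// expr1n expr0n addr0 sqrtr1. Qed.

Lemma modulusN a : modulus (- a) = modulus a.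
Proof. by case: F a => [a|[a b]] /=; rewrite ?normrN// !sqrrN. Qed.

Lemma modulus_dist a b : `|modulus a - modulus b| <= modulus (a - b).
Proof.
have h c d : modulus c - modulus d <= modulus (c - d).
  by rewrite lerBlDr (le_trans _ (modulusD _ _))// subrK.
by rewrite ler_norml h lerNl opprB -[X in _ <= X]modulusN opprB h.
Qed.

(** Convergence is phrased through the modulus, a real sequence, so that the
    completeness of the real line serves both kinds of scalars. *)
Lemma scalar_complete (z : nat -> K) :
  (forall e : R, 0 < e -> exists N, forall m n, (N <= m)%N -> (N <= n)%N ->
     modulus (z m - z n) <= e) ->
  exists l : K, (fun n => modulus (z n - l)) @ \oo --> (0 : R).
Proof.
have RC (u : nat -> R) : (forall e : R, 0 < e -> exists N, forall m n,
     (N <= m)%N -> (N <= n)%N -> `|u m - u n| <= e) ->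
    exists l : R, (fun n => `|u n - l|) @ \oo --> (0 : R).
  move=> h; exists (lim (u @ \oo)).
  suff c : u @ \oo --> lim (u @ \oo).
    have := cvg_norm (cvgB c (cvg_cst (lim (u @ \oo)))).
    by rewrite subrr normr0; apply.
  apply/cauchy_cvgP/cauchyP => e e0.
  have [N hN] := h (e / 2) (divr_gt0 e0 (ltr0Sn _ 1)).
  exists (u N); exists N => // n /= Nn; rewrite /ball /=.
  rewrite (le_lt_trans (hN _ _ (leqnn N) Nn))// ltr_pdivrMr//.
  by rewrite ltr_pMr// ltr1n.
case: F z => [z|z] /= h; first exact: RC z h.
have [e|a ha] := RC (fun n => complex.Re (z n)).
  move=> /h[N hN]; exists N => m n Nm Nn; apply: le_trans (hN _ _ Nm Nn).
  case: (z m) (z n) => [a1 a2] [b1 b2] /=.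
  by rewrite -sqrtr_sqr ler_wsqrtr// lerDl sqr_ge0.
have [e|b hb] := RC (fun n => complex.Im (z n)).
  move=> /h[N hN]; exists N => m n Nm Nn; apply: le_trans (hN _ _ Nm Nn).
  case: (z m) (z n) => [a1 a2] [b1 b2] /=.
  by rewrite -sqrtr_sqr ler_wsqrtr// lerDr sqr_ge0.
exists (Complex a b).
have hab := [elaborate cvgD ha hb]; rewrite addr0 in hab.
apply: (squeeze_cvgr _ (cvg_cst 0) hab).
near=> n; rewrite fctE; case: (z n) => [u v] /=; rewrite sqrtr_ge0/=.
rewrite -[leRHS]ger0_norm ?addr_ge0// -sqrtr_sqr ler_wsqrtr//.
rewrite -(real_normK (num_real (u - a))) -(real_normK (num_real (v - b))).
by rewrite sqrrD lerD2r lerDl mulrn_wge0// mulr_ge0.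
Unshelve. all: by end_near. Qed.

End Scalars.

(** * Norm and completeness of l2 *)

Lemma big_ord_pad (V : nmodType) (c : nat -> V) n m : (n <= m)%N ->
  \sum_(i < n) c i = \sum_(i < m) if (i < n)%N then c i else 0.
Proof. by move=> nm; rewrite -big_mkcond /= (big_ord_widen _ c nm). Qed.

Section Ell2.
Context (R : realType) (F : scalar_kind).
Local Notation K := (Defs.scalar R F).
Local Notation H := (ell2 R F).
Implicit Types x y z : H.

Lemma sqr_ell2_norm_cvg x :
  series (fun n => modulus (x n) ^+ 2) @ \oo --> ell2_norm x ^+ 2.
Proof. by rewrite sqr_ell2_norm; exact: ell2_cvg. Qed.

Lemma ell2_norm_ge_partial x N :
  \sum_(i < N) modulus (x i) ^+ 2 <= ell2_norm x ^+ 2.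
Proof.
rewrite sqr_ell2_norm; apply: le_trans (ell2_partial_sum_le x N).
by rewrite /series /= big_mkord.
Qed.

Lemma ell2_norm_le x (C : R) : 0 <= C ->
  (forall N, \sum_(i < N) modulus (x i) ^+ 2 <= C ^+ 2) -> ell2_norm x <= C.
Proof.
move=> C0 h; rewrite -ler_sqr ?nnegrE ?ell2_norm_ge0//.
apply: (cvgr_to_le (@sqr_ell2_norm_cvg x)).
by near=> N; rewrite /series /= big_mkord; exact: h.
Unshelve. all: by end_near. Qed.

Lemma modulus_le_ell2_norm x n : modulus (x n) <= ell2_norm x.
Proof.
rewrite -ler_sqr ?nnegrE ?ell2_norm_ge0 ?modulus_ge0//.
apply: le_trans (ell2_norm_ge_partial x n.+1).
by rewrite big_ord_recr/= lerDr sumr_ge0// => i _; exact: sqr_ge0.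
Qed.

Lemma mem_square_summable (u : nat -> K) (B : R) :
  (forall N, \sum_(i < N) modulus (u i) ^+ 2 <= B) ->
  (u : nat -> K^o) \in @square_summable R F.
Proof.
move=> h; apply/square_summableP; apply: nondecreasing_is_cvgn.
  by apply: nondecreasing_series => n _ _; exact: sqr_ge0.
by exists B => _ [N _ <-]; rewrite /series/= big_mkord.
Qed.

Lemma ell2_norm0 : ell2_norm (0 : H) = 0.
Proof. by rewrite -(scale0r 0) ell2_normZ modulus0 mul0r. Qed.

Lemma ell2_normN x : ell2_norm (- x) = ell2_norm x.
Proof. by rewrite -scaleN1r ell2_normZ modulusN modulus1 mul1r. Qed.

(** This inclusion-exclusion identity, like the parallelogram law, holds
    coordinatewise; it is what makes the polarized form below additive. *)
Lemma ell2_norm_add3 x y z :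
  ell2_norm (x + y + z) ^+ 2 + ell2_norm x ^+ 2 + ell2_norm y ^+ 2
    + ell2_norm z ^+ 2 =
  ell2_norm (x + y) ^+ 2 + ell2_norm (x + z) ^+ 2 + ell2_norm (y + z) ^+ 2.
Proof.
pose S x := series (fun n => modulus (x n) ^+ 2).
have h t : S t @ \oo --> ell2_norm t ^+ 2 by exact: sqr_ell2_norm_cvg.
have cL := [elaborate cvgD (cvgD (cvgD (h (x + y + z)) (h x)) (h y)) (h z)].
have cR := [elaborate cvgD (cvgD (h (x + y)) (h (x + z))) (h (y + z))].
rewrite -(cvg_lim (@norm_hausdorff _ _) cL).
rewrite -(cvg_lim (@norm_hausdorff _ _) cR).
congr (lim (_ @ \oo)); apply/funext => N.
rewrite !fctE /S /series /= -!big_split /=; apply: eq_bigr => i _.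
by rewrite (modulus_add3 (x i) (y i) (z i)).
Qed.

(** The squared norm on the line through [x] in the direction [y], written with
    [x + y] in place of the inner product of [x] and [y]. *)
Lemma ell2_norm_line (s : R) x y :
  ell2_norm (x + ofreal F s *: y) ^+ 2 =
  (1 - s) * ell2_norm x ^+ 2 + s * ell2_norm (x + y) ^+ 2
  + (s ^+ 2 - s) * ell2_norm y ^+ 2.
Proof.
pose S x := series (fun n => modulus (x n) ^+ 2).
have h t : S t @ \oo --> ell2_norm t ^+ 2 by exact: sqr_ell2_norm_cvg.
have hM (c : R) t : (fun N => c * S t N) @ \oo --> c * ell2_norm t ^+ 2.
  by apply: cvgM => //; exact: cvg_cst.
have cR := [elaborate cvgD (cvgD (hM (1 - s) x) (hM s (x + y)))
  (hM (s ^+ 2 - s) y)].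
rewrite -(cvg_lim (@norm_hausdorff _ _) cR).
rewrite -(cvg_lim (@norm_hausdorff _ _) (h _)).
congr (lim (_ @ \oo)); apply/funext => N.
rewrite !fctE /S /series /= !mulr_sumr -!big_split /=; apply: eq_bigr => i _.
by rewrite -(modulus_line s (x i) (y i)).
Qed.

Lemma ell2_tail (v : H) (r : R) : 0 < r -> exists N, forall n, (N <= n)%N ->
  ell2_norm v ^+ 2 - \sum_(i < n) modulus (v i) ^+ 2 <= r.
Proof.
move=> r0; have /cvgrPdist_le/(_ r r0)[N _ hN] := @sqr_ell2_norm_cvg v.
exists N => n /hN; rewrite /series /= big_mkord.
exact: le_trans (ler_norm _).
Qed.

(** The limit is taken coordinatewise; bounds on finitely many coordinates pass
    to it, which gives both its square-summability and the convergence in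
    norm. *)
Lemma ell2_complete (v : nat -> H) :
  (forall e : R, 0 < e -> exists N, forall m n, (N <= m)%N -> (N <= n)%N ->
     ell2_norm (v m - v n) <= e) ->
  exists u : H, forall e : R, 0 < e ->
    exists N, forall n, (N <= n)%N -> ell2_norm (v n - u) <= e.
Proof.
move=> h.
have /choice[l hl] (k : nat) : exists l : K,
    (fun n => modulus (v n k - l)) @ \oo --> (0 : R).
  apply: scalar_complete => e /h[N hN]; exists N => m n Nm Nn.
  exact: le_trans (modulus_le_ell2_norm (v m - v n) k) (hN _ _ Nm Nn).
have hle e : 0 < e -> exists N, forall n, (N <= n)%N ->
    forall M, \sum_(k < M) modulus (v n k - l k) ^+ 2 <= e ^+ 2.
  move=> e0; have [N hN] := h e e0; exists N => n Nn M.
  have c : (fun m => \sum_(k < M) modulus (v n k - v m k) ^+ 2) @ \oo -->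
      \sum_(k < M) modulus (v n k - l k) ^+ 2.
    apply: (cvg_big add_continuous) => k _; rewrite expr2.
    suff cm : (fun m => modulus (v n k - v m k)) @ \oo -->
        modulus (v n k - l k).
      exact: (cvgM cm cm).
    apply/cvgrPdist_le => d d0.
    have /cvgrPdist_le/(_ d d0) := hl k; apply: filterS => m.
    rewrite sub0r normrN ger0_norm ?modulus_ge0//; apply: le_trans.
    apply: le_trans (modulus_dist _ _) _.
    by rewrite opprB [X in modulus X]addrC addrA subrK.
  apply: (cvgr_to_le c); exists N => // m /= Nm.
  apply: le_trans (ell2_norm_ge_partial (v n - v m) M) _.
  by rewrite ler_sqr ?nnegrE ?ell2_norm_ge0 ?(ltW e0)//; exact: hN.
have [N1 hN1] := hle 1 ltr01.
have lP : (l : nat -> K^o) \in @square_summable R F.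
  have -> : (l : nat -> K^o) = (v N1 : nat -> K^o) - (fun k => v N1 k - l k).
    by apply/funext => k; rewrite !fctE opprB addrC subrK.
  apply: rpredB; first exact: ell2P.
  by apply: (@mem_square_summable _ (1 ^+ 2)) => M; exact: hN1.
exists (Ell2 lP) => e e0; have [N hN] := hle e e0; exists N => n Nn.
by apply: ell2_norm_le (ltW e0) _ => M; exact: hN.
Qed.

End Ell2.

(** * The Riesz estimates for near-norming biorthogonal systems *)

Section RealInner.
Context (R : realType) (F : scalar_kind).
Local Notation K := (Defs.scalar R F).
Local Notation H := (ell2 R F).
Implicit Types (x y z u v : H) (a b c : K).

(** The real part of the inner product. *)
Definition rinner x y : R :=
  (ell2_norm (x + y) ^+ 2 - ell2_norm x ^+ 2 - ell2_norm y ^+ 2) / 2.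

Lemma rinnerDl x y z : rinner (x + y) z = rinner x z + rinner y z.
Proof.
have aux (t xy xz yz p q r : R) : t + p + q + r = xy + xz + yz ->
    (t - xy - r) / 2 = (xz - p - r) / 2 + (yz - q - r) / 2 by lra.
exact: aux (ell2_norm_add3 x y z).
Qed.

Lemma rinnerC x y : rinner x y = rinner y x.
Proof. by rewrite /rinner (addrC x) addrAC. Qed.

Lemma rinner0l y : rinner 0 y = 0.
Proof. by rewrite /rinner add0r ell2_norm0 expr0n subr0 subrr mul0r. Qed.

Lemma rinner_suml N (v : 'I_N -> H) y :
  rinner (\sum_i v i) y = \sum_i rinner (v i) y.
Proof.
by apply: (big_morph (rinner^~ y)) => [u w|]; [exact: rinnerDl|exact: rinner0l].
Qed.

Lemma rinnerZZ c x y : rinner (c *: x) (c *: y) = modulus c ^+ 2 * rinner x y.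
Proof. by rewrite /rinner -scalerDr !ell2_normZ !exprMn mulrA !mulrBr. Qed.

Lemma rinnerxx x : rinner x x = ell2_norm x ^+ 2.
Proof.
rewrite /rinner -mulr2n -scaler_nat ell2_normZ.
have -> : modulus (2%:R : K) = 2.
  have -> : (2%:R : K) = ofreal F (2 : R) by case: F => //=; rewrite rmorph_nat.
  by rewrite modulus_ofreal normr_nat.
by move: (ell2_norm x) => r; field.
Qed.

Lemma sqr_ell2_normD x y :
  ell2_norm (x + y) ^+ 2 =
  ell2_norm x ^+ 2 + 2 * rinner x y + ell2_norm y ^+ 2.
Proof.
have aux (p q r : R) : p = q + 2 * ((p - q - r) / 2) + r by field.
exact: aux.
Qed.

Lemma sqr_ell2_normDZ (s : R) x y :
  ell2_norm (x + ofreal F s *: y) ^+ 2 =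
  ell2_norm x ^+ 2 + s * (2 * rinner x y) + s ^+ 2 * ell2_norm y ^+ 2.
Proof.
have aux (p q r : R) : (1 - s) * q + s * p + (s ^+ 2 - s) * r =
    q + s * (2 * ((p - q - r) / 2)) + s ^+ 2 * r by field.
by rewrite ell2_norm_line; exact: aux.
Qed.

(** On the affine hyperplane [g = 1] every vector has norm at least
    [1 / (1 + e)].  Applied along the line through [x] and [u], at the point of
    that line closest to the origin, this bounds [<x, u> - 1]. *)
Lemma near_norming_slice (g : {linear H -> K^o}) (e : R) x u :
  0 <= e -> (forall v, modulus (g v) <= (1 + e) * ell2_norm v) ->
  ell2_norm x = 1 -> g x = 1 -> g u = 1 ->
  (rinner x u - 1) ^+ 2 <= (2 * e + e ^+ 2) * ell2_norm u ^+ 2.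
Proof.
move=> e0 gb x1 gx gu.
pose v := u - x.
have gv : g v = 0 by rewrite /v linearB gx gu subrr.
have -> : rinner x u = 1 + rinner x v.
  by rewrite -{1}(subrK x u) rinnerC rinnerDl rinnerxx x1 expr1n addrC rinnerC.
have -> : ell2_norm u ^+ 2 = 1 + 2 * rinner x v + ell2_norm v ^+ 2.
  by rewrite -{1}(subrK x u) addrC sqr_ell2_normD x1 expr1n.
have line s : 1 <= (1 + e) ^+ 2 *
    (1 + s * (2 * rinner x v) + s ^+ 2 * ell2_norm v ^+ 2).
  have <- : ell2_norm (x + ofreal F s *: v) ^+ 2 =
      1 + s * (2 * rinner x v) + s ^+ 2 * ell2_norm v ^+ 2.
    by rewrite sqr_ell2_normDZ x1 expr1n.
  rewrite -exprMn -[leLHS](expr1n _ 2) ler_sqr ?nnegrE//; last first.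
    by rewrite mulr_ge0 ?ell2_norm_ge0// addr_ge0.
  apply: le_trans (gb _).
  by rewrite linearD linearZ/= gx gv scaler0 addr0 modulus1.
have [v0|v0] := eqVneq (ell2_norm v) 0.
  by rewrite (ell2_norm_eq0 v0) rinnerC rinner0l ell2_norm0; nra.
(* The minimizer over [s] of the quadratic in [line]. *)
have := line (- rinner x v / ell2_norm v ^+ 2).
move: (rinner x v) v0 (ell2_norm_ge0 v) => r.
move: (ell2_norm v) => w w0 w1.
have {w0 w1} w0 : 0 < w ^+ 2 by rewrite exprn_gt0// lt_neqAle eq_sym w0.
move: (w ^+ 2) w0 => {}w w0.
rewrite [X in _ <= _ * X](_ : _ = (w - r ^+ 2) / w); last first.
  by field; rewrite gt_eqF.
rewrite mulrA ler_pdivlMr// mul1r => h.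
rewrite addrAC subrr add0r.
have : 0 <= 2 * e + e ^+ 2 by nra.
have := sqr_ge0 (r + 1); nra.
Qed.

(** The previous estimate for [(g u)^-1 *: u], cleared of denominators. *)
Lemma near_norming_defect (g : {linear H -> K^o}) (e : R) x u :
  0 <= e -> (forall v, modulus (g v) <= (1 + e) * ell2_norm v) ->
  ell2_norm x = 1 -> g x = 1 ->
  (rinner (g u *: x) u - modulus (g u) ^+ 2) ^+ 2 <=
  modulus (g u) ^+ 2 * ((2 * e + e ^+ 2) * ell2_norm u ^+ 2).
Proof.
move=> e0 gb x1 gx; have [->|c0] := eqVneq (g u) 0.
  by rewrite scale0r rinner0l modulus0 expr0n subrr expr0n mul0r.
set c := g u in c0 *.
have gu' : g (c^-1 *: u) = 1 by rewrite linearZ /= -/c; exact: mulVf.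
have := near_norming_slice e0 gb x1 gx gu'.
have -> : u = c *: (c^-1 *: u) by rewrite scalerA mulfV// scale1r.
move: (c^-1 *: u) => w.
rewrite scalerA mulVf// scale1r rinnerZZ ell2_normZ => h.
rewrite -[X in (_ - X) ^+ 2]mulr1 -mulrBr exprMn.
rewrite [leRHS](_ : _ = (modulus c ^+ 2) ^+ 2 *
  ((2 * e + e ^+ 2) * ell2_norm w ^+ 2)); last by ring.
by rewrite ler_wpM2l// exprn_ge0// sqr_ge0.
Qed.

Lemma AM_GM_sqr (t a b : R) :
  0 <= a -> 0 <= b -> t ^+ 2 <= a * b -> 2 * `|t| <= a + b.
Proof.
move=> a0 b0 h; rewrite -ler_sqr ?nnegrE ?mulr_ge0 ?addr_ge0//.
rewrite exprMn real_normK ?num_real//; have := sqr_ge0 (a - b); nra.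
Qed.

Lemma biorth_coef (x : nat -> H) (f : nat -> {linear H -> K^o})
    (biorth : forall n m, f n (x m) = (n == m)%:R) N (a : nat -> K) n :
  f n (\sum_(i < N) a i *: x i) = if (n < N)%N then a n else 0.
Proof.
rewrite linear_sum; case: ltnP => nN.
  rewrite (bigD1 (Ordinal nN))//= linearZ /= biorth eqxx scaler1 big1 ?addr0//.
  move=> i ni; rewrite linearZ /= biorth (_ : (n == i) = false) ?scaler0//.
  by apply/negbTE; rewrite eq_sym; exact: ni.
rewrite big1// => i _.
rewrite linearZ /= biorth (_ : (n == i) = false) ?scaler0//.
by apply/negbTE; rewrite gtn_eqF// (leq_trans (ltn_ord i)).
Qed.

Section RieszEstimate.
Variables (x : nat -> H) (f : nat -> {linear H -> K^o}) (e : nat -> R) (D : R).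
Hypothesis e_ge0 : forall n, 0 <= e n.
Hypothesis f_bound : forall n v, modulus (f n v) <= (1 + e n) * ell2_norm v.
Hypothesis x_norm : forall n, ell2_norm (x n) = 1.
Hypothesis biorth : forall n m, f n (x m) = (n == m)%:R.
Hypothesis D_gt0 : 0 < D.
Hypothesis D_bound : forall N, \sum_(n < N) (2 * e n + e n ^+ 2) <= D.

(** The parameter [t] weighs the AM-GM inequality that splits each error term
    [|a i| * d i * |u|]; it is chosen below so as to leave a factor smaller
    than [2] on the quantity that is being bounded. *)
Lemma riesz_defect N (a : nat -> K) (t : R) : 0 < t ->
  2 * `|ell2_norm (\sum_(i < N) a i *: x i) ^+ 2
        - \sum_(i < N) modulus (a i) ^+ 2| <=
  t * (\sum_(i < N) modulus (a i) ^+ 2)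
  + D / t * ell2_norm (\sum_(i < N) a i *: x i) ^+ 2.
Proof.
move=> t0; set u := \sum_(i < N) a i *: x i.
set P := ell2_norm u ^+ 2; set Q := \sum_(i < N) modulus (a i) ^+ 2.
have fu (i : 'I_N) : f i u = a i by rewrite (biorth_coef biorth) ltn_ord.
have -> : P - Q = \sum_(i < N) (rinner (a i *: x i) u - modulus (a i) ^+ 2).
  by rewrite sumrB -rinner_suml rinnerxx.
apply: (@le_trans _ _ (\sum_(i < N)
    (t * modulus (a i) ^+ 2 + (2 * e i + e i ^+ 2) * (P / t)))).
  apply: le_trans (ler_wpM2l _ (ler_norm_sum _ _ _)) _ => //.
  rewrite mulr_sumr; apply: ler_sum => i _.
  have ei := e_ge0 i; have P0 : 0 <= P by exact: sqr_ge0.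
  apply: AM_GM_sqr.
  - by rewrite mulr_ge0 ?(ltW t0)// sqr_ge0.
  - apply: mulr_ge0; last exact: divr_ge0 P0 (ltW t0).
    by rewrite addr_ge0 ?sqr_ge0// mulr_ge0.
  have := near_norming_defect u ei (@f_bound i) (x_norm i).
  rewrite biorth eqxx fu => /(_ erefl); rewrite -/P => /le_trans; apply.
  by rewrite le_eqVlt; apply/orP; left; apply/eqP; field; rewrite gt_eqF.
rewrite big_split /= -mulr_sumr lerD2l -mulr_suml.
rewrite [leRHS](_ : _ = D * (P / t)); last by ring.
by apply: ler_wpM2r (D_bound N); apply: divr_ge0 (ltW t0); exact: sqr_ge0.
Qed.

Lemma riesz_upper N (a : nat -> K) :
  ell2_norm (\sum_(i < N) a i *: x i) ^+ 2 <=
  (2 + D) * \sum_(i < N) modulus (a i) ^+ 2.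
Proof.
have := @riesz_defect N a D D_gt0.
rewrite divff ?gt_eqF// mul1r.
move: (ell2_norm (\sum_(i < N) a i *: x i) ^+ 2).
move: (\sum_(i < N) modulus (a i) ^+ 2) => Q P.
have := ler_norm (P - Q); lra.
Qed.

Lemma riesz_lower N (a : nat -> K) :
  \sum_(i < N) modulus (a i) ^+ 2 <=
  (2 + D) * ell2_norm (\sum_(i < N) a i *: x i) ^+ 2.
Proof.
have := @riesz_defect N a 1 ltr01.
rewrite divr1 mul1r.
move: (ell2_norm (\sum_(i < N) a i *: x i) ^+ 2).
move: (\sum_(i < N) modulus (a i) ^+ 2) => Q P.
have := ler_norm (Q - P); rewrite distrC; lra.
Qed.

End RieszEstimate.

End RealInner.

(** * Bounded functionals and density *)

Section Density.
Context (R : realType) (F : scalar_kind).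
Local Notation K := (Defs.scalar R F).
Local Notation H := (ell2 R F).

Lemma normr_ell2 (v : H) : `|v| = ofreal F (ell2_norm v) :> K.
Proof. by []. Qed.

Lemma ofreal_modulus_gt0 (a : K) : 0 < a -> a = ofreal F (modulus a).
Proof. by move=> a0; rewrite -modulusE gtr0_norm. Qed.

(** Continuity of [g] is what makes the supremum defining [dual_norm] that of a
    bounded set, hence meaningful. *)
Lemma dual_norm_bound (g : top_dual H) v :
  modulus (g v) <= dual_norm g * ell2_norm v.
Proof.
have [C C0 hC] : exists2 C : R, 0 <= C &
    forall w, modulus (g w) <= C * ell2_norm w.
  have /(@continuous_linear_bounded _ _ _ 0) := @dual_continuous _ _ _ g 0.
  move=> /linear_boundedP/pinfty_ex_gt0[r r0 hr].
  exists (modulus r) => [|w]; first exact: modulus_ge0.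
  rewrite -(ler_ofreal F) ofrealM -(ofreal_modulus_gt0 r0) -modulusE.
  exact: hr.
have [v0|v0] := eqVneq (ell2_norm v) 0.
  by rewrite v0 (ell2_norm_eq0 v0) linear0 modulus0 mulr0.
have vp : 0 < ell2_norm v by rewrite lt_neqAle eq_sym v0 ell2_norm_ge0.
rewrite -ler_pdivrMr//.
pose w := ofreal F (ell2_norm v)^-1 *: v.
have <- : modulus (g w) = modulus (g v) / ell2_norm v.
  rewrite linearZ /= modulusM modulus_ofreal mulrC ger0_norm//.
  by rewrite invr_ge0 ltW.
apply: sup_upper_bound.
  split.
    by exists (modulus (g 0)), 0 => //=; rewrite rnorm_ell2 ell2_norm0.
  exists C => _ [z /= z1 <-]; rewrite rnorm_ell2 in z1.
  by apply: (le_trans (hC z)); rewrite ler_piMr.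
exists w => //=; rewrite rnorm_ell2 ell2_normZ modulus_ofreal ger0_norm.
  by rewrite mulVf.
by rewrite invr_ge0 ltW.
Qed.

Lemma dense_approx (S : set H) (u : H) (r : R) : dense S -> 0 < r ->
  exists2 w, S w & ell2_norm (u - w) < r.
Proof.
move=> dS r0; have r0' : 0 < ofreal F r by rewrite -(ofreal0 R) ltr_ofreal.
have [|w [/= uw Sw]] := dS (ball u (ofreal F r)) _ (ball_open u (ofreal F r)).
  by exists u; exact: ballxx.
exists w => //.
by move: uw; rewrite -ball_normE /ball_ /= normr_ell2 ltr_ofreal.
Qed.

Lemma approx_dense (S : set H) :
  (forall u (r : R), 0 < r -> exists2 w, S w & ell2_norm (u - w) < r) ->
  dense S.
Proof.
move=> h O [u Ou] oO.
have /nbhs_ballP[r /= r0 uO] : nbhs u O by exact: open_nbhs_nbhs.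
have [|w Sw uw] := h u (modulus r).
  by rewrite -(ltr_ofreal F) ofreal0 -ofreal_modulus_gt0.
exists w; split => //; apply: uO.
by rewrite -ball_normE /ball_ /= normr_ell2 (ofreal_modulus_gt0 r0) ltr_ofreal.
Qed.

Lemma fundamental_closed_span (x : nat -> H) : fundamental x ->
  forall u, closed_span x u.
Proof.
move=> fx u B /nbhs_ballP[r /= r0 uB].
have [|w Sw uw] := @dense_approx _ u (modulus r) fx.
  by rewrite -(ltr_ofreal F) ofreal0 -ofreal_modulus_gt0.
exists w; split => //; apply: uB.
by rewrite -ball_normE /ball_ /= normr_ell2 (ofreal_modulus_gt0 r0) ltr_ofreal.
Qed.

End Density.

(** * The standard basis *)

Section StandardBasis.
Context (R : realType) (F : scalar_kind).
Local Notation K := (Defs.scalar R F).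
Local Notation H := (ell2 R F).

Definition coordinate (n : nat) (v : H) : K^o := v n.

Lemma coordinate_linear n : linear (coordinate n).
Proof. by []. Qed.

HB.instance Definition _ n :=
  GRing.isLinear.Build K H K^o *:%R (coordinate n) (coordinate_linear n).

Lemma coordinate_continuous n : continuous (coordinate n).
Proof.
apply/linear_bounded_continuous/linear_boundedP.
near=> r => v; rewrite (modulusE (v n : K)) normr_ell2.
apply: (@le_trans _ _ (1 * ofreal F (ell2_norm v))).
  by rewrite mul1r ler_ofreal; exact: modulus_le_ell2_norm.
by apply: ler_wpM2r; rewrite ?normr_ge0 -?normr_ell2//.
Unshelve. all: by end_near. Qed.

Definition coordinate_dual n : top_dual H :=
  Dual (dual_fun := coordinate n) (@coordinate_continuous n).

Lemma delta_sum (n N : nat) :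
  \sum_(i < N) modulus ((i == n :> nat)%:R : K) ^+ 2 = (n < N)%:R.
Proof.
elim: N => [|N IH]; first by rewrite big_ord0.
rewrite big_ord_recr /= IH ltnS (leq_eqVlt n N) (eq_sym n).
case: eqP => [->|_]; first by rewrite ltnn modulus1 expr1n add0r.
by rewrite modulus0 expr0n addr0.
Qed.

Lemma delta_square_summable n :
  ((fun k => (k == n)%:R) : nat -> K^o) \in @square_summable R F.
Proof.
by apply: (@mem_square_summable _ _ _ 1) => N; rewrite delta_sum lern1 leq_b1.
Qed.

Definition unit_vector n : H := Ell2 (delta_square_summable n).

Lemma unit_vector_biorthogonal : biorthogonal unit_vector coordinate_dual.
Proof. by []. Qed.

Lemma unit_vector_orthonormal n m :
  inner (unit_vector n) (unit_vector m) = (n == m)%:R.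
Proof.
apply: cvg_lim; first exact: norm_hausdorff.
apply: cvg_near_cst; exists n.+1 => // N /= nN.
rewrite /series /= big_mkord (bigD1 (Ordinal nN))//= eqxx mul1r big1 ?addr0.
  by case: eqP => _; case: F => //=; rewrite ?oppr0.
by move=> i /negbTE ni; rewrite -[(i : nat) == n]/(i == Ordinal nN) ni mul0r.
Qed.

Lemma unit_vector_fundamental : fundamental unit_vector.
Proof.
apply: approx_dense => v r r0.
have r20 : 0 < (r / 2) ^+ 2 by rewrite exprn_gt0// divr_gt0.
have [N hN] := ell2_tail v r20.
exists (\sum_(i < N) v i *: unit_vector i); first by exists N, v.
set w := v - _.
apply: (@le_lt_trans _ _ (r / 2)); last first.
  by rewrite ltr_pdivrMr// ltr_pMr// ltr1n.
apply: ell2_norm_le; first by rewrite divr_ge0// ltW.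
move=> M; apply: le_trans (hN N (leqnn N)).
rewrite lerBrDr; apply: le_trans (ell2_norm_ge_partial v (maxn M N)).
have co i : w i = if (i < N)%N then 0 else v i.
  rewrite -[LHS]/(v i - coordinate i (\sum_(i < N) v i *: unit_vector i)).
  rewrite (biorth_coef unit_vector_biorthogonal).
  by case: ifP => _; rewrite ?subrr ?subr0.
rewrite (big_ord_pad (fun i => modulus (w i) ^+ 2) (leq_maxl M N)).
rewrite (big_ord_pad (fun i => modulus (v i) ^+ 2) (leq_maxr M N)).
rewrite -big_split; apply: ler_sum => i _; rewrite co /=.
case: (i < N)%N; first by rewrite modulus0 expr0n if_same add0r.
by case: ifP => _; rewrite addr0// sqr_ge0.
Qed.

End StandardBasis.

(** * The coefficient map *)

(** The arithmetic of the approximation below, with [U = |u|], [D = |u - w|],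
    [W = |w|], and [s], [t] the square sums of the coefficients of [w] and of
    [u - w]: the closeness of [w] to [u] makes the factor [C] harmless. *)
Lemma density_constant (R : realType) (L C s t U D W : R) : 0 <= L -> 0 <= C ->
  s <= L * W ^+ 2 -> t <= C * D ^+ 2 -> W <= U + D ->
  0 < U -> D < U / (1 + C) -> 0 <= D -> 0 <= W ->
  2 * s + 2 * t <= (8 * L + 2) * U ^+ 2.
Proof.
move=> L0 C0 hs ht hW U0 hD D0 W0.
have hD' : D * (1 + C) <= U by rewrite -ler_pdivlMr ?ltW// ltr_pwDl.
have CD0 := mulr_ge0 C0 D0.
have DU : D <= U by nra.
have W2 : W ^+ 2 <= 4 * U ^+ 2 by nra.
have CD : C * D ^+ 2 <= U ^+ 2.
  by rewrite !expr2 mulrA; apply: ler_pM => //; nra.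
have LW := ler_wpM2l L0 W2; lra.
Qed.

Section CoefficientMap.
Context (R : realType) (F : scalar_kind).
Local Notation K := (Defs.scalar R F).
Local Notation H := (ell2 R F).
Variables (x : nat -> H) (f : nat -> top_dual H) (L : R).
Hypothesis biorth : biorthogonal x f.
Hypothesis L_ge1 : 1 <= L.
Hypothesis upper : forall N (a : nat -> K),
  ell2_norm (\sum_(i < N) a i *: x i) ^+ 2 <=
  L * \sum_(i < N) modulus (a i) ^+ 2.
Hypothesis lower : forall N (a : nat -> K),
  \sum_(i < N) modulus (a i) ^+ 2 <=
  L * ell2_norm (\sum_(i < N) a i *: x i) ^+ 2.

(** The estimate [lower] is transferred from the linear span to [u] by
    approximating [u] within a fraction of [|u|] that depends on [N] and on the
    norms of the functionals involved; the constant absorbs that loss, and the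
    choice is free because the constant does not depend on [N]. *)
Lemma coefficients_bounded (x_dense : fundamental x) u N :
  \sum_(i < N) modulus (f i u) ^+ 2 <= (8 * L + 2) * ell2_norm u ^+ 2.
Proof.
have L0 : 0 <= L by exact: le_trans L_ge1.
have [u0|u0] := eqVneq (ell2_norm u) 0.
  rewrite (ell2_norm_eq0 u0) ell2_norm0 expr0n mulr0 big1// => i _.
  by rewrite linear0 modulus0 expr0n.
have up : 0 < ell2_norm u by rewrite lt_neqAle eq_sym u0 ell2_norm_ge0.
pose C := \sum_(i < N) dual_norm (f i) ^+ 2.
have C0 : 0 <= C by apply: sumr_ge0 => i _; exact: sqr_ge0.
have C1 : 0 < 1 + C by apply: ltr_pwDl.
have [_ [m [a ->]] ua] := dense_approx u x_dense (divr_gt0 up C1).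
set w := \sum_(i < m) a i *: x i in ua *.
have qw : \sum_(i < N) modulus (f i w) ^+ 2 <= L * ell2_norm w ^+ 2.
  apply: le_trans (lower m a).
  have co i : f i w = if (i < m)%N then a i else 0.
    by exact: (biorth_coef biorth).
  rewrite (big_ord_pad (fun i => modulus (f i w) ^+ 2) (leq_maxr m N)).
  rewrite (big_ord_pad (fun i => modulus (a i) ^+ 2) (leq_maxl m N)).
  apply: ler_sum => i _; rewrite co.
  case: (i < m)%N; case: ifP => _ //; first exact: sqr_ge0.
  by rewrite modulus0 expr0n.
have quw : \sum_(i < N) modulus (f i (u - w)) ^+ 2 <=
    C * ell2_norm (u - w) ^+ 2.
  rewrite mulr_suml; apply: ler_sum => i _; rewrite -exprMn.
  have h := dual_norm_bound (f i) (u - w).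
  rewrite ler_sqr ?nnegrE ?modulus_ge0//.
  exact: le_trans (modulus_ge0 _) h.
have qu : \sum_(i < N) modulus (f i u) ^+ 2 <=
    2 * \sum_(i < N) modulus (f i w) ^+ 2
    + 2 * \sum_(i < N) modulus (f i (u - w)) ^+ 2.
  rewrite !mulr_sumr -big_split; apply: ler_sum => i _.
  have sq_bound (p q r : R) : 0 <= p -> p <= q + r ->
      p ^+ 2 <= 2 * r ^+ 2 + 2 * q ^+ 2.
    by move=> p0 h; have := sqr_ge0 (q - r); nra.
  apply: sq_bound (modulus_ge0 _) _.
  have {1}-> : f i u = f i (u - w) + f i w by rewrite -linearD subrK.
  exact: modulusD.
have wu : ell2_norm w <= ell2_norm u + ell2_norm (u - w).
  rewrite -[ell2_norm (u - w)]ell2_normN; apply: le_trans (ell2_normD _ _).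
  by rewrite opprB addrC subrK.
apply: le_trans qu _.
move: (ell2_norm_ge0 (u - w)) (ell2_norm_ge0 w).
exact: (density_constant L0 C0 qw quw wu up ua).
Qed.

(** The partial sums of [\sum_i v i *: x i] form a Cauchy sequence by [upper];
    their limit has the prescribed coefficients because each [f n] is
    continuous. *)
Lemma coefficients_onto (v : H) :
  exists2 u, forall n, f n u = v n & ell2_norm u <= L * ell2_norm v.
Proof.
have L0 : 0 < L by exact: lt_le_trans L_ge1.
pose T n := \sum_(i < n) v i *: x i.
pose S n := \sum_(i < n) modulus (v i) ^+ 2.
have TS m n : (n <= m)%N -> ell2_norm (T m - T n) ^+ 2 <= L * (S m - S n).
  move=> nm; pose a i := if (i < n)%N then 0 else v i : K.
  have -> : T m - T n = \sum_(i < m) a i *: x i.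
    rewrite /T (big_ord_pad (fun i => v i *: x i) nm) -sumrB.
    apply: eq_bigr => i _.
    by rewrite /a; case: ifP => _; rewrite ?subrr ?scale0r ?subr0.
  have -> : S m - S n = \sum_(i < m) modulus (a i) ^+ 2.
    rewrite /S (big_ord_pad (fun i => modulus (v i) ^+ 2) nm) -sumrB.
    apply: eq_bigr => i _.
    by rewrite /a; case: ifP => _; rewrite ?subrr ?modulus0 ?expr0n ?subr0.
  exact: upper.
have cauchyT e : 0 < e -> exists N, forall m n, (N <= m)%N -> (N <= n)%N ->
    ell2_norm (T m - T n) <= e.
  move=> e0; have [N hN] := ell2_tail v (divr_gt0 (exprn_gt0 2 e0) L0).
  exists N.
  suff h m n : (N <= n)%N -> (n <= m)%N -> ell2_norm (T m - T n) <= e.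
    move=> m n Nm Nn; have [nm|/ltnW mn] := leqP n m; first exact: h.
    by rewrite -ell2_normN opprB; exact: h.
  move=> Nn nm; rewrite -ler_sqr ?nnegrE ?ell2_norm_ge0 ?(ltW e0)//.
  apply: le_trans (TS _ _ nm) _; rewrite mulrC -ler_pdivlMr//.
  apply: le_trans (hN n Nn); rewrite lerD2r; exact: ell2_norm_ge_partial.
have [u hu] := ell2_complete cauchyT.
exists u => [n|].
  apply/eqP; rewrite -subr_eq0; apply/eqP/modulus0_eq0/eqP.
  rewrite eq_le modulus_ge0 andbT; apply/ler_addgt0Pr => e e0; rewrite add0r.
  set M := dual_norm (f n).
  have M1 : 0 < 1 + `|M| by apply: ltr_pwDl.
  have [N hN] := hu _ (divr_gt0 e0 M1).
  (* Beyond the index [n] the partial sums already have [n]-th coefficient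
     [v n]. *)
  have fT : f n (T (maxn N n.+1)) = v n.
    by rewrite (biorth_coef biorth) leq_maxr.
  rewrite -fT -linearB; apply: le_trans (dual_norm_bound _ _) _.
  rewrite -ell2_normN opprB -/M.
  have := hN (maxn N n.+1) (leq_maxl _ _); rewrite ler_pdivlMr//.
  move: (ell2_norm_ge0 (T (maxn N n.+1) - u)).
  have real (t : R) : 0 <= t -> t * (1 + `|M|) <= e -> M * t <= e.
    by move=> t0; have := ler_wpM2r t0 (ler_norm M); nra.
  exact: real.
apply/ler_addgt0Pr => e e0; have [N hN] := hu e e0.
have -> : u = T N + - (T N - u) by rewrite opprB addrC subrK.
apply: le_trans (ell2_normD _ _) _; rewrite ell2_normN.
apply: lerD (hN N (leqnn N)).
rewrite -ler_sqr ?nnegrE ?mulr_ge0 ?ell2_norm_ge0 ?(ltW L0)//.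
apply: le_trans (upper _ _) _; rewrite exprMn expr2 -mulrA.
rewrite ler_pM2l//; apply: le_trans (ell2_norm_ge_partial v N) _.
by rewrite ler_peMl// sqr_ge0.
Qed.

Lemma coefficients_equivalence : fundamental x -> total_family f ->
  equivalent x (unit_vector R F).
Proof.
move=> x_fund f_total.
have bes := coefficients_bounded x_fund.
pose A (u : H) :=
  @Ell2 R F (fun n => f n u) (mem_square_summable (bes u)).
have AE u n : A u n = f n u by [].
have /choice[B BP] (v : ell2 R F) : exists u,
    (forall n, f n u = v n) /\ ell2_norm u <= L * ell2_norm v.
  have [u] := coefficients_onto v.
  by exists u.
have AB v : A (B v) = v.
  by apply/val_inj/funext => n; exact: (BP v).1.
have A_inj u w : A u = A w -> u = w.
  move=> Auw; apply/eqP; rewrite -subr_eq0; apply/eqP/f_total => n.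
  by rewrite linearB /= -!AE Auw subrr.
have BA u : B (A u) = u by apply: A_inj; rewrite AB.
have A_lin a u w : A (a *: u + w) = a *: A u + A w.
  by apply/val_inj/funext => n; rewrite /= linearP.
have spanx := fundamental_closed_span x_fund.
have spane := fundamental_closed_span (@unit_vector_fundamental R F).
split; first by exists f.
  by exists (@coordinate_dual R F); exact: unit_vector_biorthogonal.
exists A, B; split.
- move=> n; apply/val_inj/funext => k; exact: biorth.
- split=> [a u w _ _|a u w _ _]; first exact: A_lin.
  by apply: A_inj; rewrite A_lin !AB.
- split; [exists (8 * L + 2) | exists L] => u _; rewrite !rnorm_ell2.
    apply: ell2_norm_le => [|N].
      by rewrite mulr_ge0 ?ell2_norm_ge0//; have := L_ge1; lra.
    apply: le_trans (bes u N) _; rewrite exprMn ler_wpM2r ?sqr_ge0//.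
    by rewrite expr2 ler_peMl//; have := L_ge1; lra.
  exact: (BP u).2.
- by move=> u _; split; [exact: spane | exact: BA].
- by move=> v _; split; [exact: spanx | exact: AB].
Qed.

End CoefficientMap.

Theorem theorem1p1 (R : realType) (F : scalar_kind) (eps : nat -> R)
    (eps_ge0 : forall n, 0 <= eps n) (eps_sum : cvgn (series eps))
    (x : nat -> ell2 R F) (f : nat -> top_dual (ell2 R F)) :
  M_basis x f -> normalized x -> bounded_by eps x f ->
  exists e : nat -> ell2 R F, orthonormal_basis e /\ equivalent x e.
Proof.
move=> [biorth x_fund f_total] x_norm fx_bound.
have x1 n : ell2_norm (x n) = 1 by rewrite -rnorm_ell2 x_norm.
have f_bound n v : modulus (f n v) <= (1 + eps n) * ell2_norm v.
  apply: le_trans (dual_norm_bound _ _) _.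
  rewrite ler_wpM2r ?ell2_norm_ge0//.
  by have := fx_bound n; rewrite rnorm_ell2 x1 mul1r.
pose S := limn (series eps).
have eps_partial N : \sum_(n < N) eps n <= S.
  have -> : \sum_(n < N) eps n = series eps N by rewrite /series /= big_mkord.
  apply: nondecreasing_cvgn_le eps_sum N.
  by apply: nondecreasing_series => n _ _; exact: eps_ge0.
have S0 : 0 <= S by have := eps_partial 0%N; rewrite big_ord0.
have eps_le n : eps n <= S.
  apply: le_trans (eps_partial n.+1).
  by rewrite big_ord_recr /= lerDr sumr_ge0.
(* The summand [1] makes [D] positive when all the [eps n] vanish. *)
pose D := (2 + S) * S + 1.
have D0 : 0 < D by apply: ltr_pwDr => //; rewrite mulr_ge0// addr_ge0.
have D_bound N : \sum_(n < N) (2 * eps n + eps n ^+ 2) <= D.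
  apply: (@le_trans _ _ ((2 + S) * \sum_(n < N) eps n)).
    rewrite mulr_sumr; apply: ler_sum => n _.
    by rewrite expr2 -mulrDl ler_wpM2r// lerD2l.
  by rewrite /D ler_wpDr// ler_wpM2l// addr_ge0.
pose L := 2 + D.
have L1 : 1 <= L by rewrite /L; lra.
have upper := riesz_upper (f := f) eps_ge0 f_bound x1 biorth D0 D_bound.
have lower := riesz_lower (f := f) eps_ge0 f_bound x1 biorth D_bound.
exists (unit_vector R F); split.
  by split; [exact: unit_vector_orthonormal | exact: unit_vector_fundamental].
exact: coefficients_equivalence biorth L1 upper lower x_fund f_total.
Qed.
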